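(* If $X$ is a Hausdorff space, then $|X|\le \pi\chi(X)^{\mathrm{ot}(X)\cdot\psi_c(X)\cdot aL_c(X)}$.
   Context: - $\pi\chi(X)$ ($\pi$-character) is the minimal infinite cardinal $\kappa$ such that every $x\in X$ has a local $\pi$-base of cardinality $\le\kappa$, where a family $\mathcal{V}$ of non-empty open subsets of $X$ is a local $\pi$-base at $x$ if every open neighborhood of $x$ contains some $V\in\mathcal{V}$. - $\mathrm{ot}(X)$ (o-tightness) is the smallest infinite cardinal $\kappa$ such that for every family $\mathcal{U}$ of open subsets of $X$ and every $x\in\overline{\bigcup\mathcal{U}}$ there is $\mathcal{V}\subset\mathcal{U}$ with $|\mathcal{V}|\le\kappa$ and $x\in\overline{\bigcup\mathcal{V}}$. - $\psi_c(X)$ (closed pseudocharacter, for Hausdorff $X$) is the smallest infinite cardinal $\kappa$ such that for each $x\in X$ there is a collection $\{V(\eta,x):\eta<\kappa\}$ of open neighborhoods of $x$ with $\bigcap_{\eta<\kappa}\overline{V(\eta,x)}=\{x\}$. - $aL_c(X)$ (almost Lindelöf number with respect to closed sets) is the smallest infinite cardinal $\kappa$ such that for every closed $F\subset X$ and every collection $\mathcal{V}$ of open sets in $X$ that covers $F$ there is $\mathcal{V}_0\subset\mathcal{V}$ with $|\mathcal{V}_0|\le\kappa$ such that $\{\overline{V}:V\in\mathcal{V}_0\}$ covers $F$. *)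

(* Defs.v *)
From mathcomp Require Import all_boot.
From mathcomp Require Import boolp classical_sets functions cardinality.
From mathcomp Require Import filter topology.

Set Implicit Arguments.
Unset Strict Implicit.
Unset Printing Implicit Defensive.

Local Open Scope classical_set_scope.
Local Open Scope card_scope.

(* A cardinal is represented by any type of that cardinality: [A #<= [set: K]]
   reads |A| <= K, the product type K * L is the cardinal product, and the
   function type L -> K is the cardinal power K ^ L. *)

Definition least_infinite_cardinal (P : Type -> Prop) (K : Type) : Prop :=
  [/\ infinite_set [set: K], P K &
      forall L : Type, infinite_set [set: L] -> P L -> [set: K] #<= [set: L]].

(* The value [nat] is junk, for a [P] that holds of no infinite cardinal. *)
Definition min_infinite_cardinal (P : Type -> Prop) : Type :=
  if pselect (exists K, least_infinite_cardinal P K) is left e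
  then projT1 (cid e) else nat.

Section cardinal_functions.
Variable X : topologicalType.
Implicit Types (x : X) (K : Type).

Definition local_pi_base x (V : set (set X)) : Prop :=
  (forall B, V B -> open B /\ B !=set0) /\
  (forall U, open U -> U x -> exists2 B, V B & B `<=` U).

Definition pi_character_le K : Prop :=
  forall x, exists V : set (set X), local_pi_base x V /\ V #<= [set: K].

Definition o_tightness_le K : Prop :=
  forall U : set (set X), (forall A, U A -> open A) ->
  forall x, closure (\bigcup_(A in U) A) x ->
  exists V : set (set X),
    [/\ V `<=` U, V #<= [set: K] & closure (\bigcup_(A in V) A) x].

Definition closed_pseudocharacter_le K : Prop :=
  forall x, exists V : K -> set X,
    (forall i, open (V i) /\ V i x) /\ \bigcap_i closure (V i) = [set x].

Definition almost_Lindelof_closed_le K : Prop :=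
  forall (F : set X) (V : set (set X)), closed F ->
  (forall A, V A -> open A) -> F `<=` \bigcup_(A in V) A ->
  exists V0 : set (set X),
    [/\ V0 `<=` V, V0 #<= [set: K] & F `<=` \bigcup_(A in V0) closure A].

Definition pi_character : Type := min_infinite_cardinal pi_character_le.

Definition o_tightness : Type := min_infinite_cardinal o_tightness_le.

Definition closed_pseudocharacter : Type :=
  min_infinite_cardinal closed_pseudocharacter_le.

Definition almost_Lindelof_closed : Type :=
  min_infinite_cardinal almost_Lindelof_closed_le.

End cardinal_functions.

(* Cardinals are well-ordered, so the four functions above are genuine minima
   (for the closed pseudocharacter, when the space is Hausdorff). *)

Lemma least_cardinal_family (I : Type) (i0 : I) (F : I -> Type) :
  exists i, forall j, exists f : F i -> F j, injective f.
Proof.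
pose P := forall i, F i.
pose good (A : set P) := forall i a b, A a -> A b -> a i = b i -> a = b.
have [|A [gA maxA]] := @Zorn_bigcup P good.
  move=> C Cgood Ctot i a b [A CA Aa] [B CB Bb] eab.
  have [AB|BA] := Ctot A B CA CB.
    by apply: (Cgood B CB i) => //; exact: AB.
  by apply: (Cgood A CA i) => //; exact: BA.
have [[i surj]|nsurj] := pselect (exists i, forall y, exists2 a, A a & a i = y).
  exists i => j; have /choice[g gP] : forall y, exists a, A a /\ a i = y.
    by move=> y; have [a] := surj y; exists a.
  exists (fun y => g y j) => y z /(gA j (g y) (g z) (proj1 (gP y)) (proj1 (gP z))).
  by move=> e; rewrite -(proj2 (gP y)) e (proj2 (gP z)).
have miss i : {y : F i | forall a, A a -> a i <> y}.
  apply: cid; apply: contrapT => /forallNP nomiss; apply: nsurj; exists i => y.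
  apply: contrapT => ny; apply: (nomiss y) => a Aa e; apply: ny; by exists a.
pose p : P := fun i => projT1 (miss i).
have pP i a : A a -> a i <> p i by exact: projT2 (miss i) a.
have Ap : ~ A p by move=> /(pP i0).
exfalso; apply: (maxA (A `|` [set p])).
  by split; [move=> a; left | move=> /(_ p) h; apply/Ap/h; right].
move=> i a b [Aa|->] [Ab|->] //; first exact: gA.
  by move/(pP i _ Aa).
by move/esym/(pP i _ Ab).
Qed.

Lemma injective_card_le (T U : Type) (f : T -> U) :
  injective f -> [set: T] #<= [set: U].
Proof.
move=> fI; have fI' : {in [set: T] &, injective f} by move=> a b _ _; exact: fI.
rewrite -(card_le_eql (inj_card_eq fI')); exact: card_leT.
Qed.

Lemma cardinal_total (T U : Type) : [set: T] #<= [set: U] \/ [set: U] #<= [set: T].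
Proof.
have [[] le] := least_cardinal_family true (fun b : bool => if b then T else U).
  by left; have [f fI] := le false; exact: injective_card_le fI.
by right; have [f fI] := le true; exact: injective_card_le fI.
Qed.

Lemma min_infinite_cardinalP (P : Type -> Prop) :
  (exists K, infinite_set [set: K] /\ P K) ->
  least_infinite_cardinal P (min_infinite_cardinal P).
Proof.
move=> [K0 [K0inf PK0]]; rewrite /min_infinite_cardinal.
case: pselect => [e|nomin]; first exact: projT2 (cid e).
exfalso; apply: nomin.
pose good (A : set K0) :=
  exists L : Type, [/\ infinite_set [set: L], P L & [set: L] #= A].
have good0 : good [set: K0] by exists K0; split.
have [[A gA] /= minA] := least_cardinal_family
  (exist good [set: K0] good0) (fun s => set_type (projT1 s)).
have [K [Kinf PK KA]] := gA; exists K; split=> // L Linf PL.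
have leB B : good B -> [set: K] #<= B.
  move=> gB; have [f fI] := minA (exist _ B gB).
  rewrite (card_le_eql KA) -(card_le_eql (card_setT A)) -(card_le_eqr (card_setT B)).
  exact: injective_card_le fI.
have [LK0|K0L] := cardinal_total L K0; last first.
  by apply: card_le_trans K0L; exact: leB.
have /card_leP[f] := LK0.
pose g (l : L) : K0 := val (f (exist _ l (mem_set I))).
have gI : {in [set: L] &, injective g}.
  by move=> a b _ _ /val_inj/(@inj _ _ _ f)/=; rewrite !in_setT => /(_ isT isT)[].
rewrite -(card_le_eqr (inj_card_eq gI)); apply: leB.
exists L; split=> //; rewrite card_eq_sym; exact: inj_card_eq.
Qed.

Section cardinal_functions_exist.
Variable X : topologicalType.

Let K0 : Type := (set X + nat)%type.

Let K0_infinite : infinite_set [set: K0].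
Proof.
by apply/infiniteP; apply: (@injective_card_le nat K0 inr) => a b [].
Qed.

Let subset_le_K0 (V : set (set X)) : V #<= [set: K0].
Proof.
apply: card_le_trans (card_leT V) _.
by apply: (@injective_card_le _ K0 inl) => a b [].
Qed.

Lemma pi_characterP :
  least_infinite_cardinal (@pi_character_le X) (pi_character X).
Proof.
apply: min_infinite_cardinalP; exists K0; split=> // x.
exists [set B | open B /\ B !=set0]; split=> //; split=> // U Uo Ux.
by exists U => //; split=> //; exists x.
Qed.

Lemma o_tightnessP :
  least_infinite_cardinal (@o_tightness_le X) (o_tightness X).
Proof.
apply: min_infinite_cardinalP; exists K0; split=> // U _ x Ux.
by exists U; split=> // A.
Qed.

Lemma closed_pseudocharacterP : hausdorff_space X ->
  least_infinite_cardinal (@closed_pseudocharacter_le X)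
                          (closed_pseudocharacter X).
Proof.
move=> hX; apply: min_infinite_cardinalP; exists K0; split=> // x.
pose V (i : K0) : set X :=
  if i is inl A then (if pselect (open A /\ A x) then A else setT) else setT.
exists V; split.
- move=> [A|n] /=; last by split=> //; exact: openT.
  by case: pselect => [[Ao Ax]|nA] /=; split=> //; exact: openT.
rewrite eqEsubset; split=> [y Vy|_ -> i _]; last first.
  by apply: subset_closure; case: i => [A|n] //=; case: pselect => [[]|] /=.
apply: contrapT => /eqP yx; move: (hX); rewrite open_hausdorff => /(_ _ _ yx).
move=> [[A B] /= [/set_mem Ay /set_mem Bx] [Ao Bo AB]].
have := Vy (inl B) I; rewrite /V; case: pselect => [AB'|[]]//= /(_ A).
have /[swap]/[apply] : nbhs y A by exact: open_nbhs_nbhs.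
by move=> [z [Bz Az]]; move: AB => /eqP; rewrite -subset0 => /(_ z); exact.
Qed.

Lemma almost_Lindelof_closedP :
  least_infinite_cardinal (@almost_Lindelof_closed_le X)
                          (almost_Lindelof_closed X).
Proof.
apply: min_infinite_cardinalP; exists K0; split=> // F V _ _ FV.
by exists V; split=> // x /FV[A VA Ax]; exists A => //; exact: subset_closure.
Qed.

End cardinal_functions_exist.

(* Main.v *)
Require Import Defs.
From mathcomp Require Import all_boot.
From mathcomp Require Import boolp classical_sets functions cardinality.
From mathcomp Require Import filter topology.

Local Open Scope classical_set_scope.
Local Open Scope card_scope.

Set Implicit Arguments.
Unset Strict Implicit.
Unset Printing Implicit Defensive.

(** Let [K] be the product of the o-tightness, the closed pseudocharacter and the
    almost Lindelof number of [X], and [P] its [pi]-character. Fix at each point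
    [x] a local [pi]-base [B x p], indexed by [p : P], and open neighborhoods
    [W x j], indexed by [j : K], whose closures meet in [x] alone. A point [x]
    of the closure of a set [A] is then coded by [K]-many data from [A], [P] and
    [K]: for each [j], the members of the [pi]-bases at points of [A] that lie
    inside [W x j] have [x] in the closure of their union, by o-tightness [K] of
    them suffice ([closure_pi_base_trace]), and [x] is the only point common to
    the closures of the [K] unions so obtained.

    Let [A] be generated from one point by two kinds of operations of arity [K]:
    recover a point from such a code, and choose a point outside
    [\bigcup_k closure (W (x k) (j k))] when there is one. Closure under the first
    kind makes [A] closed. If a point [y] were not in [A], each [x] in [A] would
    have a neighborhood [W x j] whose closure misses [y]; the closures of [K] of
    them would cover [A], and the second kind of operation would produce a point
    of [A] outside this cover. So [A] is the whole space
    ([card_le_pi_character_power]).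

    It remains to see that [A] has at most [P ^ K] points. Instead of a
    transfinite recursion of length [K ^+], the points of [A] are named by
    well-founded [K]-branching trees labelled by operations; such a tree is
    determined by its labels along finite paths ([generated_set_card]), and there
    are at most [P ^ K] such labellings ([embeds_labels]), because [K * K] and
    [list K] are no larger than [K] for infinite [K] ([embeds_square],
    [embeds_list]). *)

(** * Comparing cardinals by injections *)

(** [embeds T U] reads |T| <= |U|: it is [#<=] on full sets, without the
    detour through sets. *)
Definition embeds (T U : Type) : Prop := exists f : T -> U, injective f.

Lemma card_le_embeds (T U : Type) : [set: T] #<= [set: U] -> embeds T U.
Proof.
move=> /card_leP[f]; exists (fun t => val (f (exist _ t (mem_set I)))).
move=> a b /val_inj /(@inj _ _ _ f) /=; rewrite !in_setT.
by move=> /(_ isT isT) [].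
Qed.

Lemma embeds_trans (U T V : Type) : embeds T U -> embeds U V -> embeds T V.
Proof. by move=> [f fI] [g gI]; exists (g \o f); exact: inj_comp. Qed.

Lemma embeds_infinite (T : Type) : infinite_set [set: T] -> embeds nat T.
Proof. by move=> /infiniteP /card_le_embeds. Qed.

Lemma embeds_cancel (T U : Type) : T -> embeds T U ->
  exists (f : T -> U) (g : U -> T), cancel f g.
Proof.
move=> t0 [f fI].
have /choice[g gP] : forall u, exists t, forall t', f t' = u -> t = t'.
  move=> u; have [[t <-]|nt] := pselect (exists t, f t = u).
    by exists t => t' /fI.
  by exists t0 => t' e; case: nt; exists t'.
by exists f, g => t; exact: gP.
Qed.

Lemma embeds_fun (A B C D : Type) : D -> embeds A B -> embeds C D ->
  embeds (A -> C) (B -> D).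
Proof.
move=> d0 AB [g gI]; have [[a0]|nA] := pselect (inhabited A).
  have [f [f' fK]] := embeds_cancel a0 AB.
  exists (fun u b => g (u (f' b))) => u v e; apply/funext => a; apply: gI.
  by have := congr1 (fun w => w (f a)) e; rewrite /= fK.
by exists (fun=> fun=> d0) => u v _; apply/funext => a; case: nA.
Qed.

Lemma card_le_enum (T K : Type) (A : set T) (a0 : T) :
  A a0 -> A #<= [set: K] -> exists e : K -> T, range e = A.
Proof.
move=> Aa0 /pfcard_geP[A0|[e]]; first by rewrite A0 in Aa0.
by exists e; exact: image_eq.
Qed.

(** * Infinite cardinals are idempotent *)

Lemma sval_inj (T : Type) (P : T -> Prop) : injective (@sval T P).
Proof. by move=> [a Pa] [b Pb] /= e; exact: eq_exist. Qed.

Section square.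
Variables (T : Type) (i : nat -> T).
Hypothesis i_inj : injective i.

(** The set [D] on which a relation [G], read as a map from [D * D] to [D], is
    defined. *)
Definition diagonal_domain (G : set (T * T * T)) : set T :=
  [set x | exists z, G (x, x, z)].

(** [G] encodes an injection of [D * D] into [D], where [D = diagonal_domain G]:
    [G (x, y, z)] says that [(x, y)] may be sent to [z]. Several values are
    allowed, as one can be chosen at will; injectivity is required of all. *)
Definition partial_pairing (G : set (T * T * T)) : Prop :=
  [/\ forall x y z, G (x, y, z) ->
        [/\ diagonal_domain G x, diagonal_domain G y & diagonal_domain G z],
      forall x y, diagonal_domain G x -> diagonal_domain G y ->
        exists z, G (x, y, z) &
      forall p q z, G (p, z) -> G (q, z) -> p = q].

(** The pairing of the naturals, carried by [i]: the least stage of the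
    construction. *)
Let G0 : set (T * T * T) :=
  [set t | exists m n, t = (i m, i n, i (pickle (m, n)))].

Let G0_pairing : partial_pairing G0.
Proof.
have D0 m : diagonal_domain G0 (i m) by exists (i (pickle (m, m))), m, m.
split.
- by move=> x y z [m [n [-> -> ->]]].
- move=> x y [_ [m [_ [-> _ _]]]] [_ [n [_ [-> _ _]]]].
  by exists (i (pickle (m, n))), m, n.
move=> p q z [m [n [-> ->]]] [m' [n' [-> /i_inj]]].
by move=> /(pcan_inj pickleK) [-> ->].
Qed.

(** Stages are taken in the form [G0 `|` G] so that the union of the empty chain
    is a stage as well. *)
Let chain_pairing (F : set (set (T * T * T))) :
  F `<=` [set G | partial_pairing (G0 `|` G)] -> total_on F subset ->
  partial_pairing (G0 `|` \bigcup_(G in F) G).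
Proof.
move=> Fgood Ftot.
have common s t : (G0 `|` \bigcup_(G in F) G) s ->
    (G0 `|` \bigcup_(G in F) G) t ->
    exists G, [/\ partial_pairing G, G s, G t &
                  G `<=` G0 `|` \bigcup_(G in F) G].
  have sub G : F G -> G0 `|` G `<=` G0 `|` \bigcup_(G in F) G.
    by move=> FG u [|Gu]; [left | right; exists G].
  move=> [s0|[G FG Gs]] [t0|[H FH Ht]].
  - by exists G0; split => //; left.
  - by exists (G0 `|` H); split; [exact: Fgood | left | right | exact: sub].
  - by exists (G0 `|` G); split; [exact: Fgood | right | left | exact: sub].
  have [GH|HG] := Ftot _ _ FG FH.
    exists (G0 `|` H); split; [exact: Fgood | | by right | exact: sub].
    by right; exact: GH.
  exists (G0 `|` G); split; [exact: Fgood | by right | | exact: sub].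
  by right; exact: HG.
split.
- move=> x y z Gxyz; have [G [[Gdom _ _] /Gdom[[a ?] [b ?] [c ?]] _ sub]] :=
    common _ _ Gxyz Gxyz.
  by split; [exists a | exists b | exists c]; exact: sub.
- move=> x y [a Gx] [b Gy].
  have [G [[_ Gtot _] Gxa Gyb sub]] := common _ _ Gx Gy.
  have [z Gz] : exists z, G (x, y, z) by apply: Gtot; [exists a | exists b].
  by exists z; exact: sub.
move=> p q z Gp Gq; have [G [[_ _ Ginj] Gpz Gqz _]] := common _ _ Gp Gq.
exact: Ginj Gpz Gqz.
Qed.

(** The domain [A] of a maximal partial pairing above [G0] cannot be doubled
    inside [T], so its complement is no larger than [A], and [T] itself embeds
    in [A]. *)
Lemma embeds_square_of_seq : embeds (T * T) T.
Proof.
have [M [Mgood Mmax]] := Zorn_bigcup chain_pairing.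
move: Mgood; set G := G0 `|` M => Ggood.
have [Gdom Gtot Ginj] := Ggood; set A := diagonal_domain G.
have Ai m : A (i m) by exists (i (pickle (m, m))); left; exists m, m.
have /choice[h0 h0P] : forall p : T * T, exists z,
    A p.1 -> A p.2 -> G (p.1, p.2, z).
  move=> [x y]; have [[Ax Ay]|nA] := pselect (A x /\ A y).
    by have [z Gz] := Gtot _ _ Ax Ay; exists z.
  by exists x => Ax Ay; case: nA.
pose h x y := h0 (x, y).
have hG x y : A x -> A y -> G (x, y, h x y) by exact: h0P (x, y).
have hA x y : A x -> A y -> A (h x y).
  by move=> Ax Ay; have [] := Gdom _ _ _ (hG _ _ Ax Ay).
have hI x y x' y' : A x -> A y -> A x' -> A y' ->
    h x y = h x' y' -> x = x' /\ y = y'.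
  move=> Ax Ay Ax' Ay' e; have := hG _ _ Ax Ay; rewrite e => H.
  by have [] := Ginj _ _ _ H (hG _ _ Ax' Ay').
have hhA x y m : A x -> A y -> A (h (h x y) (i m)).
  by move=> Ax Ay; exact: hA (hA _ _ Ax Ay) (Ai m).
have [small|big] := cardinal_total {x | A x} {x | ~ A x}.
  (* The complement of [A] holds a copy of [A]: [G] extends to both copies,
     against maximality. *)
  have [j0 j0I] := card_le_embeds small.
  pose j x := if pselect (A x) is left Ax then sval (j0 (exist _ x Ax)) else x.
  have jA x : A x -> ~ A (j x).
    by rewrite /j; case: pselect => // Ax _; exact: svalP (j0 _).
  have jI x y : A x -> A y -> j x = j y -> x = y.
    rewrite /j; case: pselect => // Ax; case: pselect => // Ay _ _ e.
    suff /j0I[] : j0 (exist _ x Ax) = j0 (exist _ y Ay) by [].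
    exact: sval_inj e.
  pose u (b : bool) x := if b then j x else x.
  have uI b c x y : A x -> A y -> u b x = u c y -> b = c /\ x = y.
    move=> Ax Ay; case: b; case: c => //=.
    - by move=> /(jI _ _ Ax Ay).
    - by move=> e; case: (jA _ Ax); rewrite e.
    - by move=> e; case: (jA _ Ay); rewrite -e.
  (* The pairs with a coordinate in [j @` A] are sent into [j @` A]; the
     number [b + c.*2] records which of their coordinates lie there. *)
  pose new x y (b c : bool) := j (h (h x y) (i (b + c.*2))).
  have newI x y b c x' y' b' c' : A x -> A y -> A x' -> A y' ->
      new x y b c = new x' y' b' c' -> [/\ x = x', y = y', b = b' & c = c'].
    move=> Ax Ay Ax' Ay' /jI e.
    have /hI[] := e (hhA _ _ _ Ax Ay) (hhA _ _ _ Ax' Ay');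
      try by [exact: hA | exact: Ai].
    by move=> /hI[] // -> -> /i_inj; case: b c b' c' {e} => [] [] [] [].
  pose G' : set (T * T * T) := G `|` [set t | exists x y b c,
    [/\ A x, A y, b || c & t = (u b x, u c y, new x y b c)]].
  have uD b x : A x -> diagonal_domain G' (u b x).
    move=> Ax; case: b; last by have [z Gz] := Ax; exists z; left.
    by exists (new x x true true); right; exists x, x, true, true.
  have Du x : diagonal_domain G' x -> exists b y, A y /\ x = u b y.
    move=> [z [Gz|[y [_ [b [_ [Ay _ _ [-> _ _]]]]]]]]; last by exists b, y.
    by exists false, x; split => //; exists z.
  have G'good : partial_pairing G'.
    split.
    - move=> x y z [/Gdom[Ax Ay Az]|[a [a' [b [c [Aa Aa' _ [-> -> ->]]]]]]].
        by split; exact: (uD false).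
      split; [exact: uD | exact: uD | apply: (uD true)].
      exact: hhA.
    - move=> _ _ /Du[b [x [Ax ->]]] /Du[c [y [Ay ->]]].
      case bc : (b || c); last first.
        by exists (h x y); left; case: b c bc => [] [] // _; exact: hG.
      by exists (new x y b c); right; exists x, y, b, c.
    move=> p q z [Gp|[x [y [b [c [Ax Ay bc [-> ->]]]]]]].
      move=> [Gq|[x [y [b [c [Ax Ay bc [_ ez]]]]]]]; first exact: Ginj Gp Gq.
      case: p Gp => a a' /Gdom[_ _]; rewrite ez => Az.
      by case: (jA _ _ Az); exact: hhA.
    move=> [|[x' [y' [b' [c' [Ax' Ay' bc' [-> /newI]]]]]]].
      case: q => a a' /Gdom[_ _ Az]; case: (jA _ _ Az); exact: hhA.
    by move=> /(_ Ax Ay Ax' Ay') [-> -> -> ->].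
  exfalso; apply: (Mmax G').
    split; first by move=> t Mt; left; right.
    move=> /(_ (j (i 0), j (i 0), new (i 0) (i 0) true true)) MG'.
    have /MG' Mt : G' (j (i 0), j (i 0), new (i 0) (i 0) true true).
      by right; exists (i 0), (i 0), true, true.
    have [_ _ Az] := Gdom _ _ _ (or_intror Mt).
    by case: (jA _ _ Az); exact: hhA.
  rewrite /= (_ : G0 `|` G' = G') //.
  by rewrite eqEsubset; split => [t [G0t|//]|t]; [left; left | right].
(* Otherwise [T] is covered by two copies of [A], which [A] absorbs. *)
have [k0 k0I] := card_le_embeds big.
pose k x := if pselect (A x) is right nAx then sval (k0 (exist _ x nAx)) else x.
have kA x : ~ A x -> A (k x).
  by rewrite /k; case: pselect => // nAx _; exact: svalP (k0 _).
have kI x y : ~ A x -> ~ A y -> k x = k y -> x = y.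
  rewrite /k; case: pselect => // nAx; case: pselect => // nAy _ _ e.
  suff /k0I[] : k0 (exist _ x nAx) = k0 (exist _ y nAy) by [].
  exact: sval_inj e.
pose g x := if pselect (A x) then h x (i 0) else h (k x) (i 1).
have gA x : A (g x).
  by rewrite /g; case: pselect => Ax; apply: hA => //; exact: kA.
have gI x y : g x = g y -> x = y.
  rewrite /g; case: pselect => [Ax|nAx]; case: pselect => [Ay|nAy].
  - by move=> /hI[].
  - by move=> /hI[] //; [exact: kA | move=> _ /i_inj].
  - by move=> /hI[] //; [exact: kA | move=> _ /i_inj].
  - by move=> /hI[]//; [exact: kA | exact: kA | move=> /kI ->].
exists (fun p => h (g p.1) (g p.2)) => -[x y] [x' y'] /= /hI[] //.
by move=> /gI -> /gI ->.
Qed.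

End square.

Lemma embeds_square (T : Type) : embeds nat T -> embeds (T * T) T.
Proof. by move=> [i iI]; exact: embeds_square_of_seq iI. Qed.

Lemma embeds_sum (A B T : Type) : embeds nat T -> embeds A T -> embeds B T ->
  embeds (A + B) T.
Proof.
move=> natT [f fI] [g gI]; have [i iI] := natT.
apply: embeds_trans (embeds_square natT).
exists (fun s => match s with inl a => (i 0, f a) | inr b => (i 1, g b) end).
by move=> [a|b] [a'|b'] [] // => [/fI|/iI|/iI|/gI] // ->.
Qed.

Lemma embeds_option (A T : Type) : embeds nat T -> embeds A T ->
  embeds (option A) T.
Proof.
move=> natT AT; have [i iI] := natT.
apply: (@embeds_trans (A + unit)); last first.
  by apply: embeds_sum => //; exists (fun=> i 0) => -[] [].
exists (fun o => if o is Some a then inl a else inr tt).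
by move=> [a|] [b|] // [->].
Qed.

Lemma embeds_list (T : Type) : embeds nat T -> embeds (list T) T.
Proof.
move=> natT; have [p pI] := embeds_square natT; have [i iI] := natT.
pose code := foldr (fun x c => p (x, c)) (i 0).
exists (fun s => p (i (size s), code s)) => s t /pI[/iI].
elim: s t => [|x s IH] [|y t] //= [/IH st] /pI[-> /st ->] //.
Qed.

(** * Sets generated by infinitary operations *)

(** Well-founded trees whose nodes carry a label in [L] and one subtree for each
    element of [K]: terms over a constant and [L]-many operations of arity
    [K]. *)
Inductive tree (L K : Type) : Type :=
| Leaf : tree L K
| Node : L -> (K -> tree L K) -> tree L K.

(** The label found by following a finite path from the root, if the tree
    reaches that far. *)
Fixpoint label_at (L K : Type) (t : tree L K) (s : list K) : option L :=
  match t, s with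
  | Leaf, _ => None
  | Node l f, [::] => Some l
  | Node l f, k :: s' => label_at (f k) s'
  end.

Lemma label_at_inj (L K : Type) : injective (@label_at L K).
Proof.
elim=> [|l f IH] [|l' f'] // e.
- by have := congr1 (@^~ [::]) e.
- by have := congr1 (@^~ [::]) e.
have [->] := congr1 (@^~ [::]) e; congr Node.
apply/funext => k; apply: IH; apply/funext => s.
by have := congr1 (@^~ (k :: s)) e.
Qed.

(** A set generated from a point by [L]-many operations of arity [K] is no larger
    than the set of terms, each of which is determined by its labels along
    finite paths. *)
Lemma generated_set_card (X L K : Type) (x0 : X) (op : L -> (K -> X) -> X) :
  exists A : set X, [/\ A x0,
    forall l f, (forall k, A (f k)) -> A (op l f) &
    A #<= [set: list K -> option L]].
Proof.
pose eval := fix eval (t : tree L K) : X :=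
  if t is Node l f then op l (fun k => eval (f k)) else x0.
exists (range eval); split.
- by exists (Leaf L K).
- move=> l f Af; have /choice[t tP] : forall k, exists t, eval t = f k.
    by move=> k; have [t _ tk] := Af k; exists t.
  by exists (Node l t) => //=; congr op; apply/funext.
- apply: card_le_trans (card_image_le _ _) _.
  exact: injective_card_le (@label_at_inj L K).
Qed.

(** The power [P ^ K] bounds the number of labels in [(K -> P) + (K -> K)], hence
    of label functions on finite paths, since
    [(P ^ K) ^ (list K) = P ^ (K * K) = P ^ K]. *)
Lemma embeds_labels (K P : Type) : embeds nat K -> embeds nat P ->
  embeds (list K -> option ((K -> P) + (K -> K))) (K -> P).
Proof.
move=> natK natP; have [i iI] := natK; have [q qI] := natP.
pose E := K -> P; pose c0 : E := fun=> q 0.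
have PE : embeds P E.
  by exists (fun p _ => p) => a b /(congr1 (@^~ (i 0))).
have natE : embeds nat E by exact: embeds_trans PE.
have KE : embeds K E.
  exists (fun k k' => if pselect (k' = k) then q 0 else q 1) => a b.
  move=> /(congr1 (@^~ a)) /=.
  by case: (pselect (a = a)) => // ?; case: pselect => // ? /qI.
have powE : embeds (K -> E) E.
  apply: (@embeds_trans (K * K -> P)).
    exists (fun u p => u p.1 p.2) => u v e.
    apply/funext => a; apply/funext => b.
    by have := congr1 (@^~ (a, b)) e.
  apply: embeds_fun (embeds_square natK) _; first exact: q 0.
  by exists id.
have labE : embeds ((K -> P) + (K -> K)) E.
  apply: embeds_sum => //; first by exists id.
  by apply: embeds_trans powE; apply: embeds_fun => //; exists id.
apply: embeds_trans powE; apply: embeds_fun => //.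
  exact: embeds_list.
exact: embeds_option.
Qed.

(** * Monotonicity of the cardinal functions *)

Section monotone.
Variable X : topologicalType.

Lemma o_tightness_le_embeds (O K : Type) :
  embeds O K -> @o_tightness_le X O -> @o_tightness_le X K.
Proof.
move=> [f fI] ot U Uo x /(ot U Uo x)[V [VU VO Vx]]; exists V; split => //.
exact: card_le_trans VO (injective_card_le fI).
Qed.

Lemma almost_Lindelof_closed_le_embeds (L K : Type) :
  embeds L K -> @almost_Lindelof_closed_le X L ->
  @almost_Lindelof_closed_le X K.
Proof.
move=> [f fI] aL F V Fc Vo /(aL F V Fc Vo)[V0 [V0V V0L FV0]].
exists V0; split => //; exact: card_le_trans V0L (injective_card_le fI).
Qed.

(** A neighborhood family indexed by [C] is reindexed by [K], with repetitions. *)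
Lemma closed_pseudocharacter_le_embeds (C K : Type) : C ->
  embeds C K -> @closed_pseudocharacter_le X C ->
  @closed_pseudocharacter_le X K.
Proof.
move=> c0 CK psi x; have [f [g fK]] := embeds_cancel c0 CK.
have [V [Vo Vx]] := psi x; exists (V \o g); split => [k|]; first exact: Vo.
rewrite -Vx eqEsubset; split => y Vy j _ /=; last exact: Vy.
by rewrite -(fK j); exact: Vy.
Qed.

End monotone.

(** * The closing-off argument *)

(** Here [B y] enumerates a local [pi]-base at [y]. The members of the [pi]-bases
    at points of [A] that lie inside [G] already have [x] in the closure of
    their union, and o-tightness thins them down to [K] members. Asking for
    members inside [G], rather than intersecting them with [G], keeps the number
    of possible families independent of [G]. *)
Lemma closure_pi_base_trace (X : topologicalType) (K P : Type)
    (B : X -> P -> set X) (A G : set X) (x : X) :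
  @o_tightness_le X K ->
  (forall y p, open (B y p) /\ B y p !=set0) ->
  (forall y U, open U -> U y -> exists p, B y p `<=` U) ->
  open G -> G x -> closure A x ->
  exists (y : K -> X) (p : K -> P),
    [/\ forall k, A (y k), forall k, B (y k) (p k) `<=` G &
        closure (\bigcup_k B (y k) (p k)) x].
Proof.
move=> ot Bo Bbase Go Gx Ax.
pose U := [set D | exists y p, [/\ A y, D = B y p & D `<=` G]].
have [|N Nx|V [VU VK Vx]] := ot U _ x.
- by move=> _ [y [p [_ -> _]]]; have [] := Bo y p.
- have := Nx; rewrite nbhsE => -[O [Oo Ox] ON].
  have OGx : nbhs x (O `&` G).
    by apply: open_nbhs_nbhs; split => //; exact: openI.
  have [y [Ay [Oy Gy]]] := Ax _ OGx.
  have [p pOG] := Bbase y (O `&` G) (openI Oo Go) (conj Oy Gy).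
  have [_ [z Bz]] := Bo y p; exists z.
  split; last by apply: ON; have [] := pOG z Bz.
  by exists (B y p) => //; exists y, p; split => // w /pOG[].
have [D VD] : exists D, V D.
  by have [z [[D VD _] _]] := Vx _ filterT; exists D.
have [e eV] := card_le_enum VD VK.
have /choice[d dP] : forall k, exists yp : X * P,
    [/\ A yp.1, e k = B yp.1 yp.2 & e k `<=` G].
  move=> k; have /VU[y [p yp]] : V (e k) by rewrite -eV; exists k.
  by exists (y, p).
exists (fun k => (d k).1), (fun k => (d k).2); split => [k|k|].
- by have [] := dP k.
- by have [_ <-] := dP k.
apply: closureS Vx => z [W]; rewrite -eV => -[k _ <-] ekz.
by exists k => //; have [_ <-] := dP k.
Qed.

(** The theorem for given bounds: [K] for o-tightness, closed pseudocharacter and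
    almost Lindelof number, and [P] for the [pi]-character. *)
Lemma card_le_pi_character_power (X : topologicalType) (K P : Type) :
  embeds nat K -> embeds nat P ->
  @pi_character_le X P -> @o_tightness_le X K ->
  @closed_pseudocharacter_le X K -> @almost_Lindelof_closed_le X K ->
  [set: X] #<= [set: K -> P].
Proof.
move=> natK natP pichi ot psi aL.
have [[x0]|nX] := pselect (inhabited X); last first.
  suff -> : [set: X] = set0 by [].
  by rewrite -subset0 => x _; case: nX.
have /choice[B BP] : forall x, exists B : P -> set X,
    (forall p, open (B p) /\ B p !=set0) /\
    (forall U, open U -> U x -> exists p, B p `<=` U).
  move=> x; have [V [[Vo Vbase] VP]] := pichi x.
  have [D VD _] := Vbase _ openT I; have [e eV] := card_le_enum VD VP.
  exists e; split => [p|U Uo /(Vbase U Uo)[C]].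
    by apply: Vo; rewrite -eV; exists p.
  by rewrite -eV => -[p _ <-]; exists p.
have /choice[W WP] := psi.
have [i iI] := natK.
have [enc [dec encK]] := embeds_cancel (i 0, i 0) (embeds_square natK).
(* The two kinds of operations: a point common to the closures of [K] unions of
   [pi]-base members, and a point missed by [K] closures of basic
   neighborhoods. *)
pose op (l : (K -> P) + (K -> K)) (f : K -> X) : X :=
  match l with
  | inl p => xget x0 (\bigcap_j closure (\bigcup_k
               B (f (enc (j, k))) (p (enc (j, k)))))
  | inr j => xget x0 (~` \bigcup_k closure (W (f k) (j k)))
  end.
have [A [Ax0 Aop Acard]] := generated_set_card x0 op.
have Aclosed : closed A.
  move=> x Ax.
  have /choice[y yP] : forall j, exists yp : (K -> X) * (K -> P),
    [/\ forall k, A (yp.1 k), forall k, B (yp.1 k) (yp.2 k) `<=` W x j &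
        closure (\bigcup_k B (yp.1 k) (yp.2 k)) x].
    move=> j; have [Wo Wx] := (WP x).1 j.
    have [||y [p yp]] :=
      @closure_pi_base_trace X K P B A (W x j) x ot _ _ Wo Wx Ax.
    - by move=> z; have [] := BP z.
    - by move=> z; have [] := BP z.
    by exists (y, p).
  have -> : x = op (inl (fun k => (y (dec k).1).2 (dec k).2))
                   (fun k => (y (dec k).1).1 (dec k).2).
    rewrite /op; apply/esym/xget_unique => [j _|z zP].
      have [_ _] := yP j; apply: closureS => z [k _ Bz].
      by exists k; rewrite ?encK.
    suff : [set x] z by [].
    rewrite -(WP x).2 => j _; apply: closureS (zP j I) => w [k _].
    by rewrite encK /=; have [_ + _] := yP j; apply.
  by apply: Aop => k; have [+ _ _] := yP (dec k).1; apply.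
suff AT : A = setT.
  rewrite -AT; apply: card_le_trans Acard _.
  have [f fI] := embeds_labels natK natP.
  exact: injective_card_le fI.
rewrite -subTset => y _; apply: contrapT => nAy.
have /choice[n nP] : forall x, exists j, A x -> ~ closure (W x j) y.
  move=> x; apply: contrapT => /forallNP nj; apply: nAy.
  suff : [set x] y.
    by move=> ->; apply: contrapT => nAx; apply: (nj (i 0)) => /nAx.
  by rewrite -(WP x).2 => j _; apply: contrapT => nW; exact: (nj j).
have [||V [VW VK AV]] := aL A [set W x (n x) | x in A] Aclosed.
- by move=> _ [x Ax <-]; have [] := (WP x).1 (n x).
- by move=> x Ax; exists (W x (n x)); [exists x | have [] := (WP x).1 (n x)].
have [D VD _] := AV _ Ax0; have [e eV] := card_le_enum VD VK.
have /choice[t tP] : forall k, exists x, A x /\ W x (n x) = e k.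
  move=> k; have /VW[x Ax xk] : V (e k) by rewrite -eV; exists k.
  by exists x.
pose z := op (inr (n \o t)) t.
have Az : A z by apply: Aop => k; have [] := tP k.
suff : (~` \bigcup_k closure (W (t k) (n (t k)))) z.
  apply; have [C] := AV _ Az; rewrite -eV => -[k _ <-] Cz.
  by exists k => //; have [_ ->] := tP k.
by apply: xgetPex; exists y => -[k _]; apply: nP; have [] := tP k.
Qed.

Theorem theorem5p1 (X : topologicalType) (hX : hausdorff_space X) :
  [set: X] #<=
  [set: o_tightness X * closed_pseudocharacter X * almost_Lindelof_closed X
        -> pi_character X].
Proof.
have [/embeds_infinite natP pichi _] := pi_characterP X.
have [/embeds_infinite [a aI] ot _] := o_tightnessP X.
have [/embeds_infinite [b bI] psi _] := closed_pseudocharacterP hX.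
have [/embeds_infinite [c cI] aL _] := almost_Lindelof_closedP X.
apply: card_le_pi_character_power => //.
- by exists (fun m => (a m, b 0, c 0)) => m m' [/aI].
- apply: o_tightness_le_embeds ot.
  by exists (fun k => (k, b 0, c 0)) => k k' [].
- apply: (closed_pseudocharacter_le_embeds (b 0)) psi.
  by exists (fun k => (a 0, k, c 0)) => k k' [].
- apply: almost_Lindelof_closed_le_embeds aL.
  by exists (fun k => (a 0, b 0, k)) => k k' [].
Qed.
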